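(* Consider the regularized loss minimization problem $$\min_{\theta\in\Theta}\ \kappa\mathcal{R}(\theta)+\frac1N\sum_{i=1}^N\ell_\theta(\hat s_i,\hat x_i),\qquad \ell_\theta(\hat s,\hat x):=\max_{x\in\mathbb{X}(\hat s)}\big\{\langle\theta,\phi(\hat s,\hat x)-\phi(\hat s,x)\rangle+d(\hat x,x)\big\},$$ with the mixed-integer feasible set $$\mathbb{X}(\hat s)=\big\{(y,z)\in\mathbb{R}^u\times\mathbb{Z}^v:\ \hat Ay+\hat Bz\le\hat c,\ z\in\mathbb{Z}(\hat w)\big\},\qquad \hat s=(\hat A,\hat B,\hat c,\hat w),$$ the hypothesis function (with $x=(y,z)$ and $\theta=(\operatorname{vec}(Q_{yy}),\operatorname{vec}(Q),q)$, $Q_{yy}\succcurlyeq0$) $$\langle\theta,\phi(s,x)\rangle=\langle y,Q_{yy}y\rangle+\langle y,Q\phi_1(w,z)\rangle+\langle q,\phi_2(w,z)\rangle,$$ and the distance function $d(\hat x,x)=\|\hat y-y\|_\infty+d_z(\hat z,z)$. Then this problem can be reformulated as $$\begin{aligned}\min\quad&\kappa\mathcal{R}(\theta)+\frac1N\sum_{i=1}^N\beta_i\\ \text{s.t.}\quad&\theta=(\operatorname{vec}(Q_{yy}),\operatorname{vec}(Q),q)\in\Theta,\quad\lambda_{ijk}\ge0,\quad\alpha_{ijk},\beta_i\in\mathbb{R}\\ &\langle\theta,\phi(\hat s_i,\hat x_i)\rangle+\alpha_{ijk}+\langle\lambda_{ijk},\hat c_i-\hat B_iz_{ij}\rangle-\langle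 q,\phi_2(\hat w_i,z_{ij})\rangle+\langle h_k,\hat y_i\rangle+d_z(\hat z_i,z_{ij})\le\beta_i\\ &\begin{bmatrix}Q_{yy}&Q\phi_1(\hat w_i,z_{ij})+h_k+\hat A_i^\top\lambda_{ijk}\\ *&4\alpha_{ijk}\end{bmatrix}\succcurlyeq0,\end{aligned}$$ where the minimization is over $Q_{yy},Q,q,\{\lambda_{ijk}\},\{\alpha_{ijk}\},\{\beta_i\}$, the constraints are for all $(i,j,k)\in[N]\times[M_i]\times[2u]$, $\mathbb{Z}(\hat w_i)=\{z_{i1},\dots,z_{iM_i}\}$, $M_i=|\mathbb{Z}(\hat w_i)|$, and if $k\le u$ (resp. $k>u$), $h_k\in\mathbb{R}^u$ is the vector of zeros except for the $k$-th (resp. $(k-u)$-th) element, which is equal to $1$ (resp. $-1$).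
   Context: Data: signal-response pairs $\{(\hat s_i,\hat x_i)\}_{i=1}^N$ with $\hat s_i=(\hat A_i,\hat B_i,\hat c_i,\hat w_i)$ and $\hat x_i=(\hat y_i,\hat z_i)\in\mathbb{X}(\hat s_i)$. The set $\mathbb{Z}(\hat w)\subset\mathbb{Z}^v$ is bounded and may depend on $\hat w\in\mathbb{W}$. The parameter satisfies $\theta\in\mathbb{R}^{u^2+um+r}$ with $Q_{yy}\in\mathbb{R}^{u\times u}$, $Q\in\mathbb{R}^{u\times m}$, $q\in\mathbb{R}^r$; $\phi_1:\mathbb{W}\times\mathbb{Z}^v\to\mathbb{R}^m$ and $\phi_2:\mathbb{W}\times\mathbb{Z}^v\to\mathbb{R}^r$ are feature functions, and $\phi$ is the feature map determined by the displayed identity for $\langle\theta,\phi(s,x)\rangle$. $\mathcal{R}:\mathbb{R}^{u^2+um+r}\to\mathbb{R}$ is a regularization function, $\kappa\ge0$, $\Theta$ is the set of admissible parameters (with $Q_{yy}\succcurlyeq 0$ imposed), and $d_z:\mathbb{Z}^v\times\mathbb{Z}^v\to\mathbb{R}_+$ is a general distance function on the integer part. $\operatorname{vec}$ stacks the columns of a matrix, $\succcurlyeq0$ means (symmetric) positive semidefinite, $*$ denotes the block determined by symmetry, $[n]=\{1,\dots,n\}$. ''Can be reformulated as'' means the two optimization problems are equivalent (same optimal value and same optimal $\theta$).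
   Formalization: False as stated if some z in Z(w_i) admits no y with A_i y + B_i z <= c_i. Added: for such z and each θ in Θ with all losses finite, Q_yy d = 0 and A_i d <= 0 imply |d|_∞ <= <d, Q φ_1(w_i,z)>. Also u, N >= 1. *)

(* Defs.v *)
From HB Require Import structures.
From mathcomp Require Import all_boot all_order all_algebra.
From mathcomp Require Import all_classical all_reals all_analysis.
Set Implicit Arguments.
Unset Strict Implicit.
Unset Printing Implicit Defensive.
Import Order.TTheory GRing.Theory Num.Theory.
Import numFieldNormedType.Exports.
Local Open Scope classical_set_scope.
Local Open Scope ring_scope.

Definition dot (R : realType) n (a b : 'cV[R]_n) : R :=
  \sum_(i < n) a i 0 * b i 0.

Definition lev (R : realType) n (a b : 'cV[R]_n) : Prop :=
  forall i, a i 0 <= b i 0.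

Definition psd (R : realType) n (A : 'M[R]_n) : Prop :=
  A^T = A /\ forall x : 'cV[R]_n, 0 <= dot x (A *m x).

(* mxvec concatenates rows, whereas vec stacks columns: hence the transpose. *)
Definition vec (R : realType) m n (A : 'M[R]_(m, n)) : 'cV[R]_(n * m) :=
  (mxvec A^T)^T.

Definition intvec (R : realType) n (z : 'cV[int]_n) : 'cV[R]_n :=
  map_mx intr z.

Definition bounded_intset n (Z : set 'cV[int]_n) : Prop :=
  exists b : int, forall z, Z z -> forall i, `|z i 0| <= b.

(* The number of linear constraints may vary from one signal to another. *)
Record signal (R : realType) (u v : nat) (W : Type) := Signal {
  sig_t : nat;
  sig_A : 'M[R]_(sig_t, u);
  sig_B : 'M[R]_(sig_t, v);
  sig_c : 'cV[R]_sig_t;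
  sig_w : W }.

Definition response (R : realType) (u v : nat) : Type :=
  ('cV[R]_u * 'cV[int]_v)%type.

Definition feasible (R : realType) (u v : nat) (W : Type)
    (Z : W -> set 'cV[int]_v) (s : signal R u v W) : set (response R u v) :=
  [set x | lev (sig_A s *m x.1 + sig_B s *m intvec R x.2) (sig_c s)
           /\ Z (sig_w s) x.2].

Definition param (R : realType) (u m r : nat)
    (Qyy : 'M[R]_u) (Q : 'M[R]_(u, m)) (q : 'cV[R]_r) :
    'cV[R]_(u * u + m * u + r) :=
  col_mx (col_mx (vec Qyy) (vec Q)) q.

Definition feature (R : realType) (u v m r : nat) (W : Type)
    (phi1 : W -> 'cV[int]_v -> 'cV[R]_m) (phi2 : W -> 'cV[int]_v -> 'cV[R]_r)
    (s : signal R u v W) (x : response R u v) :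
    'cV[R]_(u * u + m * u + r) :=
  param (x.1 *m x.1^T) (x.1 *m (phi1 (sig_w s) x.2)^T) (phi2 (sig_w s) x.2).

Lemma dot_col_mx (R : realType) n1 n2 (a c : 'cV[R]_n1) (b d : 'cV[R]_n2) :
  dot (col_mx a b) (col_mx c d) = dot a c + dot b d.
Proof.
rewrite /dot big_split_ord /=; congr (_ + _); apply: eq_bigr => i _.
  by rewrite !col_mxEu.
by rewrite !col_mxEd.
Qed.

Lemma dot_vec_outer (R : realType) m n (A : 'M[R]_(m, n))
    (y : 'cV[R]_m) (p : 'cV[R]_n) :
  dot (vec A) (vec (y *m p^T)) = dot y (A *m p).
Proof.
rewrite /dot /vec.
transitivity (\sum_(j < n) \sum_(i < m) A i j * (y i 0 * p j 0)).
  rewrite pair_big /= (reindex _ (curry_mxvec_bij n m)) /=.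
  apply: eq_bigr => -[j i] _ /=.
  by rewrite !mxE !mxvecE !mxE big_ord1 !mxE.
rewrite exchange_big; apply: eq_bigr => i _; rewrite mxE mulr_sumr.
by apply: eq_bigr => j _; rewrite mulrCA.
Qed.

Lemma dot_param_feature (R : realType) (u v m r : nat) (W : Type)
    (phi1 : W -> 'cV[int]_v -> 'cV[R]_m) (phi2 : W -> 'cV[int]_v -> 'cV[R]_r)
    (Qyy : 'M[R]_u) (Q : 'M[R]_(u, m)) (q : 'cV[R]_r)
    (s : signal R u v W) (y : 'cV[R]_u) (z : 'cV[int]_v) :
  dot (param Qyy Q q) (feature phi1 phi2 s (y, z)) =
  dot y (Qyy *m y) + dot y (Q *m phi1 (sig_w s) z)
  + dot q (phi2 (sig_w s) z).
Proof. by rewrite /param /feature !dot_col_mx !dot_vec_outer. Qed.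

(* The norm on 'cV[R]_u is mx_norm, i.e. the sup norm. *)
Definition dist (R : realType) (u v : nat)
    (dz : 'cV[int]_v -> 'cV[int]_v -> R) (x x' : response R u v) : R :=
  `|x.1 - x'.1| + dz x.2 x'.2.

(* Equal to +oo when the maximum is not finite. *)
Definition loss (R : realType) (u v m r : nat) (W : Type)
    (Z : W -> set 'cV[int]_v)
    (phi1 : W -> 'cV[int]_v -> 'cV[R]_m) (phi2 : W -> 'cV[int]_v -> 'cV[R]_r)
    (dz : 'cV[int]_v -> 'cV[int]_v -> R)
    (theta : 'cV[R]_(u * u + m * u + r))
    (s : signal R u v W) (xh : response R u v) : \bar R :=
  ereal_sup [set (dot theta (feature phi1 phi2 s xh - feature phi1 phi2 s x)
                  + dist dz xh x)%:E | x in feasible Z s].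

Definition loss_objective (R : realType) (u v m r : nat) (W : Type)
    (Z : W -> set 'cV[int]_v)
    (phi1 : W -> 'cV[int]_v -> 'cV[R]_m) (phi2 : W -> 'cV[int]_v -> 'cV[R]_r)
    (dz : 'cV[int]_v -> 'cV[int]_v -> R)
    (kappa : R) (reg : 'cV[R]_(u * u + m * u + r) -> R)
    (N : nat) (s : 'I_N -> signal R u v W) (xh : 'I_N -> response R u v)
    (theta : 'cV[R]_(u * u + m * u + r)) : \bar R :=
  ((kappa * reg theta)%:E
   + (N%:R^-1)%:E * \sum_(i < N) loss Z phi1 phi2 dz theta (s i) (xh i))%E.

(* 'I_(u + u) plays the role of {1, ..., 2u}: its first u elements give the
   vectors e_j, its last u elements the vectors - e_j. *)
Definition hvec (R : realType) (u : nat) (k : 'I_(u + u)) : 'cV[R]_u :=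
  match fintype.split k with
  | inl j => delta_mx j 0
  | inr j => - delta_mx j 0
  end.

Record variables (R : realType) (u v m r : nat) (W : Type) (N : nat)
    (s : 'I_N -> signal R u v W) (M : 'I_N -> nat) := Variables {
  var_Qyy : 'M[R]_u;
  var_Q : 'M[R]_(u, m);
  var_q : 'cV[R]_r;
  var_lambda : forall i : 'I_N, 'I_(M i) -> 'I_(u + u) -> 'cV[R]_(sig_t (s i));
  var_alpha : forall i : 'I_N, 'I_(M i) -> 'I_(u + u) -> R;
  var_beta : 'I_N -> R }.
Arguments var_lambda {R u v m r W N s M} _ i _ _.
Arguments var_alpha {R u v m r W N s M} _ i _ _.

Definition var_theta (R : realType) (u v m r : nat) (W : Type) (N : nat)
    (s : 'I_N -> signal R u v W) (M : 'I_N -> nat)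
    (p : variables m r s M) : 'cV[R]_(u * u + m * u + r) :=
  param (var_Qyy p) (var_Q p) (var_q p).

Definition reformulation_feasible (R : realType) (u v m r : nat) (W : Type)
    (phi1 : W -> 'cV[int]_v -> 'cV[R]_m) (phi2 : W -> 'cV[int]_v -> 'cV[R]_r)
    (dz : 'cV[int]_v -> 'cV[int]_v -> R)
    (Theta : set 'cV[R]_(u * u + m * u + r))
    (N : nat) (s : 'I_N -> signal R u v W) (xh : 'I_N -> response R u v)
    (M : 'I_N -> nat) (z : forall i, 'I_(M i) -> 'cV[int]_v) :
    set (variables m r s M) :=
  [set p | Theta (var_theta p) /\
    forall (i : 'I_N) (j : 'I_(M i)) (k : 'I_(u + u)),
      let w := sig_w (s i) in
      let lambda := var_lambda p i j k in
      let alpha := var_alpha p i j k in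
      [/\ lev 0 lambda,
          dot (var_theta p) (feature phi1 phi2 (s i) (xh i)) + alpha
          + dot lambda (sig_c (s i) - sig_B (s i) *m intvec R (z i j))
          - dot (var_q p) (phi2 w (z i j)) + dot (hvec R k) (xh i).1
          + dz (xh i).2 (z i j) <= var_beta p i
        & let b := var_Q p *m phi1 w (z i j) + hvec R k
                   + (sig_A (s i))^T *m lambda in
          psd (block_mx (var_Qyy p) b b^T (4 * alpha)%:M)]].

Definition reformulation_objective (R : realType) (u v m r : nat) (W : Type)
    (kappa : R) (reg : 'cV[R]_(u * u + m * u + r) -> R)
    (N : nat) (s : 'I_N -> signal R u v W) (M : 'I_N -> nat)
    (p : variables m r s M) : \bar R :=
  (kappa * reg (var_theta p) + N%:R^-1 * \sum_(i < N) var_beta p i)%:E.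

Definition optimal_value (R : realType) (T : Type) (F : set T)
    (f : T -> \bar R) : \bar R :=
  ereal_inf [set f x | x in F].

(* A point whose objective value is +oo violates the implicit constraint that
   the objective be finite, hence it is never a minimizer. *)
Definition minimizer (R : realType) (T : Type) (F : set T)
    (f : T -> \bar R) (x : T) : Prop :=
  [/\ F x, f x \is a fin_num & forall x', F x' -> (f x <= f x')%E].

(* A vector z of Z(w) for which no y satisfies A y + B z <= c does not
   contribute to the loss, whereas the semidefinite constraints attached to z
   are solvable only if, whenever Qyy d = 0 and A d <= 0, the direction d is
   not one of strict ascent for any of the functions
   y |-> - <y, Qyy y> - <y, Q phi1(w, z) + h_k>. This is what is required
   below, for the parameters of finite loss. The condition is void if every z
   in Z(w) admits such a y; it also holds if Qyy d = 0 and A d <= 0 force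
   d = 0, e.g. if Qyy is positive definite or if {y | A y + B z <= c} is
   nonempty and bounded for some z. *)
Definition no_ascent_on_empty_fibers (R : realType) (u v m r : nat) (W : Type)
    (Z : W -> set 'cV[int]_v)
    (phi1 : W -> 'cV[int]_v -> 'cV[R]_m) (phi2 : W -> 'cV[int]_v -> 'cV[R]_r)
    (dz : 'cV[int]_v -> 'cV[int]_v -> R)
    (Theta : set 'cV[R]_(u * u + m * u + r))
    (N : nat) (s : 'I_N -> signal R u v W) (xh : 'I_N -> response R u v) :
    Prop :=
  forall (Qyy : 'M[R]_u) (Q : 'M[R]_(u, m)) (q : 'cV[R]_r),
    Theta (param Qyy Q q) ->
    (forall i, loss Z phi1 phi2 dz (param Qyy Q q) (s i) (xh i) < +oo)%E ->
  forall (i : 'I_N) (z : 'cV[int]_v),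
    Z (sig_w (s i)) z ->
    ~ (exists y : 'cV[R]_u, feasible Z (s i) (y, z)) ->
  forall d : 'cV[R]_u,
    Qyy *m d = 0 -> lev (sig_A (s i) *m d) 0 ->
    `|d| <= dot d (Q *m phi1 (sig_w (s i)) z).

(* Main.v *)
Require Import Defs.
From mathcomp Require Import all_boot all_order all_algebra.
From mathcomp Require Import all_classical all_reals all_analysis.
From mathcomp Require Import ring lra.
Set Implicit Arguments.
Unset Strict Implicit.
Unset Printing Implicit Defensive.
Import Order.TTheory GRing.Theory Num.Theory.
Import numFieldNormedType.Exports.
Local Open Scope classical_set_scope.
Local Open Scope ring_scope.

(** For fixed theta the two problems agree sample by sample. The set Z(w) is
    finite and the sup norm is the maximum of the 2u linear functions <h_k, .>,
    so the i-th loss is at most beta iff, for every z in Z(w) and every k,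
    the convex quadratic function of y
      beta - <theta, phi(xh) - phi(y, z)> - <h_k, yh - y> - dz(zh, z)
    is nonnegative on the polyhedron A y <= c - B z [loss_le]. Lagrangian
    duality says that this amounts to the existence of a multiplier
    lambda >= 0 for which the quadratic plus <lambda, A y + B z - c> is
    nonnegative on the whole space, and a quadratic function is nonnegative
    everywhere iff its homogenization is a positive semidefinite form, which
    is the displayed matrix inequality [psd_block_quadratic].

    One direction is weak duality [fiber_dual_sound]. The other needs a
    multiplier that attains the dual bound, without any Slater condition. If
    the polyhedron is nonempty, this is [convex_affine_duality], valid for all
    convex functions that are finite everywhere and finitely many affine
    constraints. It is proved by induction on the number of constraints, with
    no topology beyond suprema of real numbers: if the function is
    nonnegative without the first constraint, drop it; otherwise some point a
    of negative value violates it, one projects onto the hyperplane where the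
    constraint is an equality, along the direction from a feasible point to a,
    and the remaining constraint is handled by separating two sets of slopes
    [affine_multiplier].

    If the polyhedron is empty, the primal condition is void, and the dual
    must be shown feasible and unbounded. Unboundedness comes from a Farkas
    certificate [infeasible_certificate] added with a large weight, and
    feasibility from the assumption on directions d with Qyy d = 0 and
    A d <= 0 [dual_feasible]: it gives |d| <= <d, Q phi1>, and
    |d| >= - <d, h_k>, hence <d, Q phi1 + h_k> >= 0.

    Consequently a point of the reformulation bounds the loss objective at its
    theta from above, and each admissible theta of finite objective lifts to a
    point of the reformulation with the same objective. These two facts yield
    equal optimal values and matching minimizers [projection_equivalence]. *)

(** * Lagrange multipliers for convex functions under affine constraints *)

Definition affine_fun (R : realType) (V W : lmodType R) (g : V -> W) : Prop :=
  forall (t : R) x y,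
    g (t *: x + (1 - t) *: y) = t *: g x + (1 - t) *: g y.

Definition convex_fun (R : realType) (V : lmodType R) (f : V -> R) : Prop :=
  forall (t : R) x y, 0 <= t <= 1 ->
    f (t *: x + (1 - t) *: y) <= t * f x + (1 - t) * f y.

(** The point x + s (a - b) is the midpoint of 2 x - b and
    2 s a + (1 - 2 s) b, two affine combinations of two points each. *)
Lemma affine_fun_translate (R : realType) (V : lmodType R) (g : V -> R^o)
    (a b x : V) (s : R) :
  affine_fun g -> g (x + s *: (a - b)) = g x + s * (g a - g b).
Proof.
move=> ga.
have -> : x + s *: (a - b) =
    2^-1 *: (2 *: x + (1 - 2) *: b)
    + (1 - 2^-1) *: ((2 * s) *: a + (1 - 2 * s) *: b).
  rewrite !scalerDr !scalerA -[RHS]addrA [_ *: b + (_ + _)]addrCA -scalerDl.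
  rewrite scalerN -scaleNr; congr (_ + (_ + _)).
  - by rewrite mulVf ?pnatr_eq0// scale1r.
  - by congr (_ *: _); field.
  - by congr (_ *: _); field.
by rewrite !ga /GRing.scale /=; field.
Qed.

Lemma convex_fun_comp (R : realType) (V : lmodType R) (f : V -> R)
    (p : V -> V) :
  convex_fun f -> affine_fun p -> convex_fun (f \o p).
Proof. by move=> fc pa t x y t01 /=; rewrite pa; exact: fc. Qed.

Lemma affine_fun_comp (R : realType) (V : lmodType R) (g : V -> R^o)
    (p : V -> V) :
  affine_fun g -> affine_fun p -> affine_fun (g \o p).
Proof. by move=> ga pa t x y /=; rewrite pa ga. Qed.

Lemma convex_funD_affine (R : realType) (V : lmodType R) n (f : V -> R)
    (g : 'I_n -> V -> R^o) (l : 'I_n -> R) :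
  convex_fun f -> (forall i, affine_fun (g i)) ->
  convex_fun (fun y => f y + \sum_i l i * g i y).
Proof.
move=> fc ga t x y t01; have := fc t x y t01.
have -> : \sum_i l i * g i (t *: x + (1 - t) *: y) =
    t * \sum_i l i * g i x + (1 - t) * \sum_i l i * g i y.
  rewrite !mulr_sumr -big_split/=; apply: eq_bigr => i _.
  by rewrite ga /GRing.scale /=; ring.
lra.
Qed.

(** The multiplier is a slope: it must dominate - h / g where g > 0 and be
    dominated by - h / g where g < 0. By convexity, a segment joining the two
    sides meets the hyperplane g = 0 at a point where h is nonnegative, so all
    slopes of the first kind lie below all those of the second, and their
    supremum works. The point a makes it nonnegative, and b makes it
    finite. *)
Lemma affine_multiplier (R : realType) (V : lmodType R) (h : V -> R)
    (g : V -> R^o) (a b : V) :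
  convex_fun h -> affine_fun g ->
  (forall y, g y = 0 -> 0 <= h y) ->
  h a < 0 -> 0 < g a -> g b < 0 ->
  exists2 mu : R, 0 <= mu & forall y, 0 <= h y + mu * g y.
Proof.
move=> hc ga h0 ha ga0 gb0.
have cross x y : 0 < g x -> g y < 0 -> - h x / g x <= h y / (- g y).
  (* t x + (1 - t) y is where the segment crosses the hyperplane g = 0. *)
  move=> gx gy; pose t : R := - g y / (g x - g y).
  have d0 : 0 < g x - g y by rewrite subr_gt0 (lt_trans gy).
  have t1 : 1 - t = g x / (g x - g y) by rewrite /t; field; rewrite gt_eqF.
  have t01 : 0 <= t <= 1.
    rewrite -[t <= 1]subr_ge0 t1 /t.
    by rewrite !divr_ge0 ?oppr_ge0 ?(ltW gx) ?(ltW gy) ?(ltW d0).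
  have /h0 : g (t *: x + (1 - t) *: y) = 0.
    by rewrite ga t1 /t /GRing.scale /=; field; rewrite gt_eqF.
  move=> /le_trans /(_ (hc t x y t01)).
  rewrite t1 /t ![_ / _ * _]mulrAC -mulrDl pmulr_lge0 ?invr_gt0// => H.
  rewrite ler_pdivrMr// mulrAC ler_pdivlMr ?oppr_gt0//; lra.
pose E := [set r | exists2 x, 0 < g x & r = - h x / g x].
have Ea : E (- h a / g a) by exists a.
have ubE y : g y < 0 -> ubound E (h y / (- g y)).
  by move=> gy r [x gx ->]; exact: cross.
have hub : has_ubound E by exists (h b / (- g b)); exact: ubE.
exists (sup E).
  apply: le_trans (ub_le_sup hub Ea).
  by rewrite divr_ge0 ?ltW// oppr_gt0.
move=> y; case: (ltgtP (g y) 0) => gy.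
- have : sup E <= h y / (- g y).
    by apply: ge_sup; [exists (- h a / g a)|exact: ubE].
  rewrite ler_pdivlMr ?oppr_gt0//; lra.
- have : - h y / g y <= sup E by apply: ub_le_sup => //; exists y.
  rewrite ler_pdivrMr//; lra.
- by rewrite gy mulr0 addr0; exact: h0.
Qed.

(** Strong duality with an attained multiplier and no Slater condition. The
    delicate case is that of a constraint g ord0 which cannot be dropped: then
    there is a point a with f a < 0 satisfying the others. Restricting f to
    the hyperplane g ord0 = 0 by the projection p and applying the induction
    hypothesis reduces the problem to the single constraint g ord0, where a
    lies strictly on one side; prolonging a line through a beyond the
    hyperplane gives a point strictly on the other. *)
Theorem convex_affine_duality (R : realType) (V : lmodType R) n (f : V -> R)
    (g : 'I_n -> V -> R^o) (x : V) :
  convex_fun f -> (forall i, affine_fun (g i)) ->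
  (forall i, g i x <= 0) ->
  (forall y, (forall i, g i y <= 0) -> 0 <= f y) ->
  exists2 l : 'I_n -> R, (forall i, 0 <= l i) &
    forall y, 0 <= f y + \sum_i l i * g i y.
Proof.
elim: n f g x => [|n IHn] f g x fc ga gx fge0.
  exists (fun=> 0) => // y; rewrite big_ord0 addr0.
  by apply: fge0 => -[].
pose g' i := g (lift ord0 i).
have ga' i : affine_fun (g' i) by exact: ga.
have split_l (l : 'I_n -> R) mu y :
    \sum_i (if unlift ord0 i is Some j then l j else mu) * g i y =
    mu * g ord0 y + \sum_i l i * g' i y.
  rewrite big_ord_recl unlift_none; congr (_ + _).
  by apply: eq_bigr => i _; rewrite liftK.
suff [mu mu0 [l l0 lP]] : exists2 mu : R, 0 <= mu &
    exists2 l : 'I_n -> R, (forall i, 0 <= l i) &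
      forall y, 0 <= f y + (mu * g ord0 y + \sum_i l i * g' i y).
  exists (fun i => if unlift ord0 i is Some j then l j else mu).
    by move=> i; case: unliftP.
  by move=> y; rewrite split_l.
have [fge0'|] := pselect (forall y, (forall i, g' i y <= 0) -> 0 <= f y).
  have [l l0 lP] := IHn f g' x fc ga' (fun i => gx _) fge0'.
  by exists 0 => //; exists l => // y; rewrite mul0r add0r.
move=> /existsNP[a /not_implyP[ga0 /negP]]; rewrite -ltNge => fa.
have g0a : 0 < g ord0 a.
  rewrite ltNge; apply/negP => g0a; move: fa; rewrite ltNge fge0// => i.
  by case: (unliftP ord0 i) => [j ->|->//]; exact: ga0.
have gxa : 0 < g ord0 a - g ord0 x by rewrite subr_gt0 (le_lt_trans (gx _)).
(* The projection onto the hyperplane g ord0 = 0 along a - x: it sends the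
   feasible point x into the segment from x to a, hence keeps it feasible. *)
pose p y := y + (- g ord0 y / (g ord0 a - g ord0 x)) *: (a - x).
have pa : affine_fun p.
  move=> t y y'; rewrite /p; move: (a - x) => w; set D := g ord0 a - _.
  have -> : - g ord0 (t *: y + (1 - t) *: y') / D =
      t * (- g ord0 y / D) + (1 - t) * (- g ord0 y' / D).
    by rewrite ga /GRing.scale /=; field; rewrite gt_eqF.
  by rewrite !scalerDr [_ *: w]scalerDl !scalerA addrACA.
have gp y : g ord0 (p y) = 0.
  by rewrite /p affine_fun_translate//; field; rewrite gt_eqF.
have pE y : g ord0 y = 0 -> p y = y.
  by move=> gy; rewrite /p gy oppr0 mul0r scale0r addr0.
have gpx i : g' i (p x) <= 0.
  rewrite /p affine_fun_translate//; set s := _ / _.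
  have s0 : 0 <= s by apply: divr_ge0; [rewrite oppr_ge0|exact: ltW].
  have s1 : s <= 1 by rewrite /s ler_pdivrMr// mul1r; lra.
  have := gx (lift ord0 i); have := ga0 i; rewrite -/(g' i) => *; nra.
have fge0p y : (forall i, (g' i \o p) y <= 0) -> 0 <= (f \o p) y.
  move=> gy; apply: fge0 => i.
  by case: (unliftP ord0 i) => [j ->|->]; [exact: gy | rewrite gp].
have [l l0 lP] := IHn (f \o p) (fun i => g' i \o p) x
  (convex_fun_comp fc pa) (fun i => affine_fun_comp (ga' i) pa) gpx fge0p.
pose h y := f y + \sum_i l i * g' i y.
have hc : convex_fun h by exact: convex_funD_affine.
have h0 y : g ord0 y = 0 -> 0 <= h y.
  by move=> /pE py; have := lP y; rewrite /= py.
have ha : h a < 0.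
  apply: le_lt_trans fa; rewrite gerDl sumr_le0// => i _.
  by rewrite mulr_ge0_le0.
have gb : g ord0 (p x + -1 *: (a - x)) < 0.
  by rewrite affine_fun_translate// gp; lra.
have [mu mu0 muP] := affine_multiplier hc (ga ord0) h0 ha g0a gb.
exists mu => //; exists l => // y.
by rewrite addrCA addrC; exact: muP.
Qed.

(** * The Euclidean product *)

Lemma dotE (R : realType) n (a b : 'cV[R]_n) : dot a b = (a^T *m b) 0 0.
Proof. by rewrite mxE; apply: eq_bigr => i _; rewrite mxE. Qed.

Lemma dotC (R : realType) n (a b : 'cV[R]_n) : dot a b = dot b a.
Proof. by apply: eq_bigr => i _; rewrite mulrC. Qed.

Lemma dotDr (R : realType) n (a b c : 'cV[R]_n) :
  dot a (b + c) = dot a b + dot a c.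
Proof. by rewrite !dotE mulmxDr mxE. Qed.

Lemma dotDl (R : realType) n (a b c : 'cV[R]_n) :
  dot (a + b) c = dot a c + dot b c.
Proof. by rewrite dotC dotDr !(dotC c). Qed.

Lemma dotZr (R : realType) n (t : R) (a b : 'cV[R]_n) :
  dot a (t *: b) = t * dot a b.
Proof. by rewrite !dotE -scalemxAr mxE. Qed.

Lemma dotZl (R : realType) n (t : R) (a b : 'cV[R]_n) :
  dot (t *: a) b = t * dot a b.
Proof. by rewrite dotC dotZr dotC. Qed.

Lemma dotNr (R : realType) n (a b : 'cV[R]_n) : dot a (- b) = - dot a b.
Proof. by rewrite -scaleN1r dotZr mulN1r. Qed.

Lemma dotNl (R : realType) n (a b : 'cV[R]_n) : dot (- a) b = - dot a b.
Proof. by rewrite dotC dotNr dotC. Qed.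

Lemma dot0r (R : realType) n (a : 'cV[R]_n) : dot a 0 = 0.
Proof. by rewrite -(scale0r 0) dotZr mul0r. Qed.

Lemma dot_mulmxr (R : realType) m n (A : 'M[R]_(m, n)) (x : 'cV[R]_m)
    (y : 'cV[R]_n) :
  dot x (A *m y) = dot y (A^T *m x).
Proof. by rewrite dotC !dotE trmx_mul mulmxA. Qed.

Lemma dot_cV1 (R : realType) (a b : 'cV[R]_1) : dot a b = a 0 0 * b 0 0.
Proof. by rewrite /dot big_ord1. Qed.

Lemma dot_ge0 (R : realType) n (a b : 'cV[R]_n) :
  lev 0 a -> lev 0 b -> 0 <= dot a b.
Proof.
move=> a0 b0; apply: sumr_ge0 => i _; apply: mulr_ge0.
  by have := a0 i; rewrite mxE.
by have := b0 i; rewrite mxE.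
Qed.

Lemma dot_symC (R : realType) n (Q : 'M[R]_n) (x y : 'cV[R]_n) :
  Q^T = Q -> dot x (Q *m y) = dot y (Q *m x).
Proof. by move=> QT; rewrite dot_mulmxr QT. Qed.

(** * Duality for convex quadratic functions on polyhedra *)

(** The convexity gap between x and y is t (1 - t) <x - y, Q (x - y)>. *)
Lemma convex_quadratic (R : realType) n (Q : 'M[R]_n) (g : 'cV[R]_n) (c : R) :
  psd Q -> convex_fun (fun y => dot y (Q *m y) + dot y g + c).
Proof.
move=> [QT Q0] t x y /andP[t0 t1].
have := Q0 (x - y).
rewrite !(mulmxDr, mulmxN, dotDl, dotDr, dotNl, dotNr) -!scalemxAr.
rewrite !(dotZl, dotZr) (dot_symC y x)// => H.
rewrite -subr_ge0.
have /mulr_ge0/(_ H) : 0 <= t * (1 - t) by rewrite mulr_ge0 ?subr_ge0.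
by congr (0 <= _); ring.
Qed.

Lemma psd0 (R : realType) n : psd (0 : 'M[R]_n).
Proof. by split=> [|x]; rewrite ?trmx0// mul0mx dot0r. Qed.

Lemma quadratic_duality (R : realType) n t (Q : 'M[R]_n) (g : 'cV[R]_n)
    (c : R) (A : 'M[R]_(t, n)) (b : 'cV[R]_t) :
  psd Q -> (exists y, lev (A *m y) b) ->
  (forall y, lev (A *m y) b -> 0 <= dot y (Q *m y) + dot y g + c) ->
  exists2 l : 'cV[R]_t, lev 0 l &
    forall y, 0 <= dot y (Q *m y) + dot y g + c + dot l (A *m y - b).
Proof.
move=> Qpsd [y0 y0P] fge0.
have [|||l l0 lP] := @convex_affine_duality R 'cV[R]_n t
    (fun y => dot y (Q *m y) + dot y g + c)
    (fun i y => (A *m y - b) i 0) y0 (convex_quadratic g c Qpsd).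
- move=> i s x y; rewrite mulmxDr -!scalemxAr !mxE /GRing.scale /=; ring.
- by move=> i; have := y0P i; rewrite !mxE subr_le0.
- by move=> y hy; apply: fge0 => i; have := hy i; rewrite !mxE subr_le0.
exists (\col_i l i) => [i|y]; first by rewrite !mxE.
rewrite /dot; under [X in _ + X]eq_bigr do rewrite mxE.
exact: lP.
Qed.

(** Farkas: homogenize to A y <= tau b. A solution with tau > 0 would give the
    solution y / tau of A y <= b, so - tau is nonnegative on this nonempty
    cone, and its multiplier, evaluated at tau = 1, is the certificate. *)
Lemma infeasible_certificate (R : realType) n t (A : 'M[R]_(t, n))
    (b : 'cV[R]_t) :
  ~ (exists y, lev (A *m y) b) ->
  exists2 l : 'cV[R]_t, lev 0 l & forall y, 1 <= dot l (A *m y - b).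
Proof.
move=> infeas.
have AbE (y : 'cV[R]_n) (tau : R) :
    row_mx A (- b) *m col_mx y tau%:M = A *m y - tau *: b.
  by rewrite mul_row_col mulNmx mul_mx_scalar.
have e1E (y : 'cV[R]_n) (tau : R) :
    dot (col_mx y tau%:M) (col_mx 0 (- 1%:M)) = - tau.
  by rewrite dot_col_mx dot0r dot_cV1 !mxE add0r mulrN1 mulr1n.
have colE (x : 'cV[R]_(n + 1)) :
    x = col_mx (usubmx x) ((x (rshift n 0) 0)%:M).
  by rewrite -[LHS]vsubmxK; congr col_mx; rewrite [LHS]mx11_scalar mxE.
have [|y|l l0 lP] := @quadratic_duality R (n + 1) t 0
    (col_mx 0 (- 1%:M)) 0 (row_mx A (- b)) 0 (@psd0 R _).
- by exists 0; rewrite mulmx0.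
- rewrite (colE y) AbE mul0mx dot0r e1E; set tau := y _ _ => h.
  rewrite add0r addr0 oppr_ge0 leNgt; apply/negP => tau0; apply: infeas.
  exists (tau^-1 *: usubmx y) => i.
  have := h i; rewrite -scalemxAr !mxE subr_le0 => hi.
  by rewrite ler_pdivrMl.
exists l => // y; have := lP (col_mx y 1%:M).
by rewrite AbE mul0mx dot0r e1E scale1r subr0; lra.
Qed.

(** The hypothesis says that <d, g> is nonnegative on the cone A d <= 0,
    Q d = 0. Its multipliers are l for A and, for the equality, a vector mu
    of arbitrary sign. The term <mu, Q y> is then absorbed by completing the
    square in <y, Q y>. *)
Lemma dual_feasible (R : realType) n t (Q : 'M[R]_n) (g : 'cV[R]_n)
    (A : 'M[R]_(t, n)) (b : 'cV[R]_t) :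
  psd Q ->
  (forall d, Q *m d = 0 -> lev (A *m d) 0 -> 0 <= dot d g) ->
  exists c : R, exists2 l : 'cV[R]_t, lev 0 l &
    forall y, 0 <= dot y (Q *m y) + dot y g + c + dot l (A *m y - b).
Proof.
move=> [QT Q0] noray.
have AQE (y : 'cV[R]_n) : col_mx A (col_mx Q (- Q)) *m y =
    col_mx (A *m y) (col_mx (Q *m y) (- (Q *m y))).
  by rewrite !mul_col_mx mulNmx.
have [|y|l l0] := @quadratic_duality R n (t + (n + n)) 0 g 0
    (col_mx A (col_mx Q (- Q))) 0 (@psd0 R _).
- by exists 0; rewrite mulmx0.
- rewrite AQE mul0mx dot0r add0r addr0 => h; apply: noray => [|i].
    apply/matrixP => i j; rewrite ord1 mxE; apply/eqP; rewrite eq_le.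
    have := h (rshift t (lshift n i)); have := h (rshift t (rshift n i)).
    by rewrite !col_mxEd col_mxEu !mxE oppr_le0 => -> ->.
  by have := h (lshift _ i); rewrite col_mxEu !mxE.
rewrite -(vsubmxK l) -(vsubmxK (dsubmx l)).
set la := usubmx l; set m1 := usubmx _; set m2 := dsubmx (dsubmx l) => lP.
have [mu {}lP] : exists mu, forall y,
    0 <= dot y g + dot la (A *m y) + dot mu (Q *m y).
  exists (m1 - m2) => y; have := lP y.
  rewrite AQE mul0mx dot0r subr0 !dot_col_mx dotNr.
  by rewrite dotDl dotNl add0r addr0 addrA.
(* <mu, Q mu> / 4 completes the square <y - mu / 2, Q (y - mu / 2)>. *)
exists (dot mu (Q *m mu) / 4 + dot la b); exists la => [i|y].
  by have := l0 (lshift _ i); rewrite !mxE.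
have := Q0 (y - 2^-1 *: mu); have := lP y.
rewrite !(mulmxDr, mulmxN, dotDl, dotDr, dotNl, dotNr) -!scalemxAr.
by rewrite !(dotZl, dotZr) (dot_symC y mu)//; lra.
Qed.

(** On an empty polyhedron a multiplier with some constant c' in place of c can
    be corrected by |c' - c| times a certificate of infeasibility. *)
Lemma quadratic_multiplier (R : realType) n t (Q : 'M[R]_n) (g : 'cV[R]_n)
    (c : R) (A : 'M[R]_(t, n)) (b : 'cV[R]_t) :
  psd Q ->
  (forall y, lev (A *m y) b -> 0 <= dot y (Q *m y) + dot y g + c) ->
  (~ (exists y, lev (A *m y) b) ->
   forall d, Q *m d = 0 -> lev (A *m d) 0 -> 0 <= dot d g) ->
  exists2 l : 'cV[R]_t, lev 0 l &
    forall y, 0 <= dot y (Q *m y) + dot y g + c + dot l (A *m y - b).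
Proof.
move=> Qpsd fge0 noray.
have [feas|infeas] := pselect (exists y, lev (A *m y) b).
  exact: quadratic_duality.
have [c' [l l0 lP]] := dual_feasible b Qpsd (noray infeas).
have [mu mu0 muP] := infeasible_certificate infeas.
exists (l + `|c' - c| *: mu) => [i|y].
  have := l0 i; have := mu0 i; rewrite !mxE => mui li.
  by rewrite addr_ge0// mulr_ge0.
have := lP y; rewrite dotDl dotZl; have := muP y; have := ler_norm (c' - c).
have := normr_ge0 (c' - c); nra.
Qed.

(** The quadratic form of the block matrix at (y, tau) is
    4 tau^2 times the quadratic function at y / (2 tau), which explains the
    factor 4 in the corner; for tau = 0 it is <y, Q y>. *)
Lemma psd_block_quadratic (R : realType) n (Q : 'M[R]_n) (b : 'cV[R]_n)
    (a : R) :
  psd Q ->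
  psd (block_mx Q b b^T (4 * a)%:M) <->
  forall y, 0 <= dot y (Q *m y) + dot y b + a.
Proof.
move=> [QT Q0].
have qE (y : 'cV[R]_n) (tau : R) :
    dot (col_mx y tau%:M) (block_mx Q b b^T (4 * a)%:M *m col_mx y tau%:M) =
    dot y (Q *m y) + 2 * tau * dot y b + 4 * a * tau ^+ 2.
  rewrite mul_block_col dot_col_mx dotDr mul_mx_scalar dotZr.
  rewrite dot_cV1 mul_scalar_mx !mxE.
  have -> : \sum_j b^T 0 j * y j 0 = dot y b.
    by apply: eq_bigr => j _; rewrite !mxE mulrC.
  by rewrite mulr1n; ring.
split=> [[_ h] y|h].
  have := h (col_mx (2 *: y) 1%:M).
  by rewrite qE -scalemxAr !(dotZl, dotZr); lra.
split=> [|x].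
  by rewrite tr_block_mx trmxK tr_scalar_mx QT.
rewrite -(vsubmxK x) [dsubmx x]mx11_scalar qE.
move: (usubmx x) (dsubmx x 0 0) => y tau.
have [->|tau0] := eqVneq tau 0; first by have := Q0 y; lra.
have := h ((2 * tau)^-1 *: y).
have /mulr_ge0 : 0 <= 4 * tau ^+ 2 by rewrite mulr_ge0// sqr_ge0.
move=> /[apply]; rewrite -scalemxAr !(dotZl, dotZr).
by congr (0 <= _); field.
Qed.

(** * The sup norm as a maximum of linear functions *)

Lemma dot_hvec (R : realType) u (k : 'I_(u + u)) (x : 'cV[R]_u) :
  dot (hvec R k) x =
  match fintype.split k with inl j => x j 0 | inr j => - x j 0 end.
Proof.
have dot_delta j : dot (delta_mx j 0) x = x j 0.
  rewrite /dot (bigD1 j)//= !mxE !eqxx mul1r big1 ?addr0// => i /negPf ij.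
  by rewrite mxE ij mul0r.
by rewrite /hvec; case: fintype.split => j; rewrite ?dotNl dot_delta.
Qed.

Lemma dot_hvec_le_norm (R : realType) u (k : 'I_(u + u)) (x : 'cV[R]_u) :
  dot (hvec R k) x <= `|x|.
Proof.
have le_norm j : `|x j 0| <= `|x|.
  rewrite [leRHS]mx_normrE.
  exact: (@le_bigmax _ _ _ _ (fun ij => `|x ij.1 ij.2|) (j, 0)).
rewrite dot_hvec; case: fintype.split => j; apply: le_trans (le_norm j).
  exact: ler_norm.
by rewrite -normrN ler_norm.
Qed.

Lemma norm_dot_hvec (R : realType) u (x : 'cV[R]_u) : (0 < u)%N ->
  exists k : 'I_(u + u), `|x| = dot (hvec R k) x.
Proof.
move=> u0.
have [j xj] : exists j, `|x| = `|x j 0|.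
  have [x0|/mx_norm_neq0[[i j] xij]] := eqVneq (mx_norm x) 0.
    exists (Ordinal u0); have -> : x = 0 by exact: mx_norm_eq0.
    by rewrite mxE !normr0.
  by exists i; rewrite [LHS]xij/= ord1.
have [x0|x0] := leP 0 (x j 0).
  by exists (lshift u j); rewrite dot_hvec (unsplitK (inl j)) xj ger0_norm.
by exists (rshift u j); rewrite dot_hvec (unsplitK (inr j)) xj ltr0_norm.
Qed.

Lemma param_surj (R : realType) u m r (theta : 'cV[R]_(u * u + m * u + r)) :
  exists Qyy Q q, theta = param Qyy Q q.
Proof.
have vecK a b (x : 'cV[R]_(b * a)) : vec (vec_mx x^T)^T = x.
  by rewrite /vec trmxK vec_mxK trmxK.
exists (vec_mx (usubmx (usubmx theta))^T)^T.
exists (vec_mx (dsubmx (usubmx theta))^T)^T, (dsubmx theta).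
by rewrite /param !vecK !vsubmxK.
Qed.

(** * Duality on a fiber *)

(** The expression maximized in the loss, restricted to a single z and with the
    norm replaced by one of the linear functions whose maximum it is. *)
Definition fiber_loss (R : realType) (u v m r : nat) (W : Type)
    (phi1 : W -> 'cV[int]_v -> 'cV[R]_m) (phi2 : W -> 'cV[int]_v -> 'cV[R]_r)
    (dz : 'cV[int]_v -> 'cV[int]_v -> R)
    (theta : 'cV[R]_(u * u + m * u + r))
    (s : signal R u v W) (xh : response R u v) (z : 'cV[int]_v) (h y : 'cV[R]_u)
    : R :=
  dot theta (feature phi1 phi2 s xh - feature phi1 phi2 s (y, z))
  + dot h (xh.1 - y) + dz xh.2 z.

Definition fiber_dual (R : realType) (u v m r : nat) (W : Type)
    (phi1 : W -> 'cV[int]_v -> 'cV[R]_m) (phi2 : W -> 'cV[int]_v -> 'cV[R]_r)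
    (dz : 'cV[int]_v -> 'cV[int]_v -> R)
    (Qyy : 'M[R]_u) (Q : 'M[R]_(u, m)) (q : 'cV[R]_r)
    (s : signal R u v W) (xh : response R u v) (z : 'cV[int]_v) (h : 'cV[R]_u)
    (beta : R) (lambda : 'cV[R]_(sig_t s)) (alpha : R) : Prop :=
  [/\ lev 0 lambda,
      dot (param Qyy Q q) (feature phi1 phi2 s xh) + alpha
      + dot lambda (sig_c s - sig_B s *m intvec R z)
      - dot q (phi2 (sig_w s) z) + dot h xh.1 + dz xh.2 z <= beta
    & let b := Q *m phi1 (sig_w s) z + h + (sig_A s)^T *m lambda in
      psd (block_mx Qyy b b^T (4 * alpha)%:M)].

Lemma fiber_lossE (R : realType) (u v m r : nat) (W : Type)
    (phi1 : W -> 'cV[int]_v -> 'cV[R]_m) (phi2 : W -> 'cV[int]_v -> 'cV[R]_r)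
    (dz : 'cV[int]_v -> 'cV[int]_v -> R)
    (Qyy : 'M[R]_u) (Q : 'M[R]_(u, m)) (q : 'cV[R]_r)
    (s : signal R u v W) (xh : response R u v) (z : 'cV[int]_v)
    (h y : 'cV[R]_u) :
  fiber_loss phi1 phi2 dz (param Qyy Q q) s xh z h y =
  dot (param Qyy Q q) (feature phi1 phi2 s xh) - dot q (phi2 (sig_w s) z)
  + dot h xh.1 + dz xh.2 z
  - (dot y (Qyy *m y) + dot y (Q *m phi1 (sig_w s) z + h)).
Proof.
rewrite /fiber_loss !dotDr !dotNr dot_param_feature (dotC h y).
by ring.
Qed.

(** Weak duality: add the nonnegative numbers <lambda, c - B z - A y> and the
    quadratic function attached to the matrix inequality. *)
Lemma fiber_dual_sound (R : realType) (u v m r : nat) (W : Type)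
    (phi1 : W -> 'cV[int]_v -> 'cV[R]_m) (phi2 : W -> 'cV[int]_v -> 'cV[R]_r)
    (dz : 'cV[int]_v -> 'cV[int]_v -> R)
    (Qyy : 'M[R]_u) (Q : 'M[R]_(u, m)) (q : 'cV[R]_r)
    (s : signal R u v W) (xh : response R u v) (z : 'cV[int]_v) (h : 'cV[R]_u)
    (beta : R) (lambda : 'cV[R]_(sig_t s)) (alpha : R) :
  psd Qyy -> fiber_dual phi1 phi2 dz Qyy Q q xh z h beta lambda alpha ->
  forall y, lev (sig_A s *m y) (sig_c s - sig_B s *m intvec R z) ->
    fiber_loss phi1 phi2 dz (param Qyy Q q) s xh z h y <= beta.
Proof.
move=> Qyy_psd [l0 hbeta /(psd_block_quadratic _ _ Qyy_psd) hpsd] y hy.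
apply: le_trans hbeta; rewrite fiber_lossE.
have /(dot_ge0 l0) :
    lev 0 (sig_c s - sig_B s *m intvec R z - sig_A s *m y).
  by move=> i; have := hy i; rewrite !mxE subr_ge0.
have := hpsd y; set b := sig_c s - _.
rewrite [dot lambda (_ - _)]dotDr dotNr !(dotDr y) -(dot_mulmxr _ lambda).
lra.
Qed.

(** Strong duality: alpha takes up the constant left once the quadratic
    multiplier lambda is chosen, so that the linear inequality is tight. *)
Lemma fiber_dual_complete (R : realType) (u v m r : nat) (W : Type)
    (phi1 : W -> 'cV[int]_v -> 'cV[R]_m) (phi2 : W -> 'cV[int]_v -> 'cV[R]_r)
    (dz : 'cV[int]_v -> 'cV[int]_v -> R)
    (Qyy : 'M[R]_u) (Q : 'M[R]_(u, m)) (q : 'cV[R]_r)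
    (s : signal R u v W) (xh : response R u v) (z : 'cV[int]_v) (h : 'cV[R]_u)
    (beta : R) :
  let b := sig_c s - sig_B s *m intvec R z in
  psd Qyy ->
  (forall y, lev (sig_A s *m y) b ->
     fiber_loss phi1 phi2 dz (param Qyy Q q) s xh z h y <= beta) ->
  (~ (exists y, lev (sig_A s *m y) b) ->
   forall d, Qyy *m d = 0 -> lev (sig_A s *m d) 0 ->
     0 <= dot d (Q *m phi1 (sig_w s) z + h)) ->
  exists la : 'cV[R]_(sig_t s) * R,
    fiber_dual phi1 phi2 dz Qyy Q q xh z h beta la.1 la.2.
Proof.
move=> b Qyy_psd hbeta noray; rewrite /fiber_dual -/b.
set C := dot (param Qyy Q q) _.
pose c := beta - (C - dot q (phi2 (sig_w s) z) + dot h xh.1 + dz xh.2 z).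
have cge0 y : lev (sig_A s *m y) b ->
    0 <= dot y (Qyy *m y) + dot y (Q *m phi1 (sig_w s) z + h) + c.
  by move=> /hbeta; rewrite fiber_lossE -/C /c; lra.
have [l l0 lP] := quadratic_multiplier Qyy_psd cge0 noray.
exists (l, c - dot l b); split=> //=.
  by rewrite /c; lra.
apply/psd_block_quadratic => // y; have := lP y; clearbody b c.
rewrite [dot l (_ - _)]dotDr dotNr [dot y (_ + _ *m l)]dotDr.
by rewrite (dot_mulmxr _ l); lra.
Qed.

(** * The two optimization problems *)

(** If every value of g bounds f from above at the projected point, and every
    point of finite f lifts to one whose g is no larger, then f is the partial
    minimum of g, attained wherever f is finite. This is why minimizers, not
    only values, correspond. *)
Lemma projection_equivalence (R : realType) (S T : Type) (F : set S)
    (G : set T) (f : S -> \bar R) (g : T -> \bar R) (pr : T -> S) :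
  (forall p, G p -> F (pr p) /\ (f (pr p) <= g p < +oo)%E) ->
  (forall x, F x -> (f x < +oo)%E ->
     exists p, [/\ G p, pr p = x & (g p <= f x)%E]) ->
  optimal_value F f = optimal_value G g /\
  forall x, minimizer F f x <-> exists p, minimizer G g p /\ pr p = x.
Proof.
move=> lower lift; split.
  apply/eqP; rewrite eq_le; apply/andP; split.
    apply: le_ereal_inf_tmp => _ [p /lower[Fp /andP[fg _]] <-].
    by apply: le_trans fg; apply: ereal_inf_lbound; exists (pr p).
  apply: le_ereal_inf_tmp => _ [x Fx <-].
  have [foo|] := ltP (f x) +oo%E; last first.
    by rewrite leye_eq => /eqP ->; exact: leey.
  have [p [Gp _ gf]] := lift x Fx foo.
  by apply: le_trans gf; apply: ereal_inf_lbound; exists p.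
move=> x; split=> [[Fx ffin xmin]|[p [[Gp gfin pmin] <-]]].
  have [p [Gp px gf]] : exists p, [/\ G p, pr p = x & (g p <= f x)%E].
    by apply: lift => //; rewrite ltey_eq ffin.
  exists p; split=> //.
  have [_ /andP[]] := lower p Gp; rewrite px => fg _.
  have gpE : g p = f x by apply/eqP; rewrite eq_le gf fg.
  split=> [//||p' /lower[Fp' /andP[fg' _]]]; first by rewrite gpE.
  by rewrite gpE (le_trans (xmin _ Fp')).
have [Fp /andP[fg goo]] := lower p Gp.
have lt_foo : (f (pr p) < +oo)%E by exact: le_lt_trans fg goo.
have gle x' : F x' -> (g p <= f x')%E.
  move=> Fx'; have [foo|] := ltP (f x') +oo%E.
    by have [p' [/pmin gp' _]] := lift x' Fx' foo; exact: le_trans.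
  by rewrite leye_eq => /eqP ->; exact: leey.
have fpE : f (pr p) = g p by apply/eqP; rewrite eq_le fg gle.
by split=> [//||x' Fx']; rewrite fpE// gle.
Qed.

(** The sup norm being attained by some h_k, bounding the loss is the same as
    bounding separately each of its fiberwise linearizations. *)
Lemma loss_le (R : realType) (u v m r : nat) (W : Type) (u0 : (0 < u)%N)
    (Z : W -> set 'cV[int]_v)
    (phi1 : W -> 'cV[int]_v -> 'cV[R]_m) (phi2 : W -> 'cV[int]_v -> 'cV[R]_r)
    (dz : 'cV[int]_v -> 'cV[int]_v -> R)
    (theta : 'cV[R]_(u * u + m * u + r))
    (s : signal R u v W) (xh : response R u v) (beta : R) :
  (loss Z phi1 phi2 dz theta s xh <= beta%:E)%E <->
  forall z, Z (sig_w s) z -> forall (k : 'I_(u + u)) (y : 'cV[R]_u),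
    lev (sig_A s *m y) (sig_c s - sig_B s *m intvec R z) ->
    fiber_loss phi1 phi2 dz theta s xh z (hvec R k) y <= beta.
Proof.
have levE (z : 'cV[int]_v) (y : 'cV[R]_u) :
    lev (sig_A s *m y) (sig_c s - sig_B s *m intvec R z) <->
    lev (sig_A s *m y + sig_B s *m intvec R z) (sig_c s).
  by split=> h i; have := h i; rewrite !mxE lerBrDr.
split=> [hloss z zZ k y /levE hy|hfib].
  rewrite -lee_fin; apply: le_trans hloss; apply: le_trans; last first.
    by apply: ereal_sup_ubound; exists (y, z); [split|].
  by rewrite lee_fin /fiber_loss /dist -addrA lerD2l lerD2r dot_hvec_le_norm.
apply: ge_ereal_sup => _ [[y z] [/levE hy hz] <-]; rewrite lee_fin /dist /=.
have [k ->] := norm_dot_hvec (xh.1 - y) u0.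
by rewrite addrA; exact: hfib.
Qed.

(** The observed response is itself feasible and contributes dz(zh, zh). *)
Lemma loss_ge0 (R : realType) (u v m r : nat) (W : Type)
    (Z : W -> set 'cV[int]_v)
    (phi1 : W -> 'cV[int]_v -> 'cV[R]_m) (phi2 : W -> 'cV[int]_v -> 'cV[R]_r)
    (dz : 'cV[int]_v -> 'cV[int]_v -> R)
    (theta : 'cV[R]_(u * u + m * u + r))
    (s : signal R u v W) (xh : response R u v) :
  (forall z z', 0 <= dz z z') -> feasible Z s xh ->
  (0 <= loss Z phi1 phi2 dz theta s xh)%E.
Proof.
move=> dz0 hxh; apply: le_trans (ereal_sup_ubound _); last by exists xh.
by rewrite lee_fin subrr dot0r add0r addr_ge0.
Qed.

(** Since no loss is -oo, one infinite loss makes the average infinite. *)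
Lemma loss_objective_lt_pinfty (R : realType) (u v m r : nat) (W : Type)
    (Z : W -> set 'cV[int]_v)
    (phi1 : W -> 'cV[int]_v -> 'cV[R]_m) (phi2 : W -> 'cV[int]_v -> 'cV[R]_r)
    (dz : 'cV[int]_v -> 'cV[int]_v -> R)
    (kappa : R) (reg : 'cV[R]_(u * u + m * u + r) -> R)
    (N : nat) (s : 'I_N -> signal R u v W) (xh : 'I_N -> response R u v)
    (theta : 'cV[R]_(u * u + m * u + r)) :
  (forall i, 0 <= loss Z phi1 phi2 dz theta (s i) (xh i))%E ->
  (loss_objective Z phi1 phi2 dz kappa reg s xh theta < +oo)%E ->
  forall i, (loss Z phi1 phi2 dz theta (s i) (xh i) < +oo)%E.
Proof.
move=> loss0 + i; apply: contraTT; rewrite -!leNgt !leye_eq => /eqP lossi.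
have N0 : 0 < N%:R^-1 :> R.
  by rewrite invr_gt0 ltr0n (leq_ltn_trans _ (ltn_ord i)).
rewrite /loss_objective (_ : \sum_(j < N) _ = +oo)%E.
  by rewrite gt0_muley// addey.
apply/esum_eqyP => [j _|]; first by rewrite -ltNye (lt_le_trans _ (loss0 j)).
by exists i; rewrite mem_index_enum.
Qed.

Lemma reformulation_lower_bound (R : realType) (u v m r : nat) (u0 : (0 < u)%N)
    (W : Type) (Z : W -> set 'cV[int]_v)
    (phi1 : W -> 'cV[int]_v -> 'cV[R]_m) (phi2 : W -> 'cV[int]_v -> 'cV[R]_r)
    (dz : 'cV[int]_v -> 'cV[int]_v -> R)
    (kappa : R) (reg : 'cV[R]_(u * u + m * u + r) -> R)
    (Theta : set 'cV[R]_(u * u + m * u + r))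
    (N : nat) (s : 'I_N -> signal R u v W) (xh : 'I_N -> response R u v)
    (M : 'I_N -> nat) (z : forall i : 'I_N, 'I_(M i) -> 'cV[int]_v)
    (p : variables m r s M) :
  psd (var_Qyy p) ->
  (forall i, Z (sig_w (s i)) = range (z i)) ->
  reformulation_feasible phi1 phi2 dz Theta xh z p ->
  (loss_objective Z phi1 phi2 dz kappa reg s xh (var_theta p)
   <= reformulation_objective kappa reg p)%E.
Proof.
move=> Qpsd hz [_ hp].
rewrite /loss_objective /reformulation_objective EFinD leeD2l//.
rewrite EFinM; apply: lee_wpmul2l; first by rewrite lee_fin invr_ge0.
rewrite -sumEFin; apply: lee_sum => i _; apply/loss_le => // zi.
rewrite hz => -[j _ <-] k; exact: (fiber_dual_sound Qpsd (hp i j k)).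
Qed.

(** Take beta_i to be the i-th loss, and obtain each lambda and alpha from
    strong duality. On empty fibers, the assumption on recession directions d
    compensates the worst case of <d, h_k>, since - <d, h_k> <= |d|. *)
Lemma reformulation_lift (R : realType) (u v m r : nat) (u0 : (0 < u)%N)
    (W : Type) (Z : W -> set 'cV[int]_v)
    (phi1 : W -> 'cV[int]_v -> 'cV[R]_m) (phi2 : W -> 'cV[int]_v -> 'cV[R]_r)
    (dz : 'cV[int]_v -> 'cV[int]_v -> R)
    (kappa : R) (reg : 'cV[R]_(u * u + m * u + r) -> R)
    (Theta : set 'cV[R]_(u * u + m * u + r))
    (N : nat) (s : 'I_N -> signal R u v W) (xh : 'I_N -> response R u v)
    (M : 'I_N -> nat) (z : forall i : 'I_N, 'I_(M i) -> 'cV[int]_v)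
    (Qyy : 'M[R]_u) (Q : 'M[R]_(u, m)) (q : 'cV[R]_r) :
  let theta := param Qyy Q q in
  psd Qyy ->
  (forall i, Z (sig_w (s i)) = range (z i)) ->
  no_ascent_on_empty_fibers Z phi1 phi2 dz Theta s xh ->
  Theta theta ->
  (forall i, loss Z phi1 phi2 dz theta (s i) (xh i) \is a fin_num) ->
  exists p : variables m r s M,
    [/\ reformulation_feasible phi1 phi2 dz Theta xh z p,
        var_theta p = theta
      & reformulation_objective kappa reg p
        = loss_objective Z phi1 phi2 dz kappa reg s xh theta].
Proof.
move=> theta Qpsd hz hfib Ttheta fin_loss.
pose L i := loss Z phi1 phi2 dz theta (s i) (xh i).
have dualP i j k : {la | fiber_dual (s := s i) phi1 phi2 dz Qyy Q q
    (xh i) (z i j) (hvec R k) (fine (L i)) la.1 la.2}.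
  apply/cid; apply: fiber_dual_complete => // [|empty d Qd Ad].
    have /(loss_le u0) Li : (L i <= (fine (L i))%:E)%E.
      by rewrite fineK ?fin_loss.
    by move=> y hy; apply: Li => //; rewrite hz; exists j.
  have Zij : Z (sig_w (s i)) (z i j) by rewrite hz; exists j.
  have /= := hfib Qyy Q q Ttheta _ i (z i j) Zij _ d Qd Ad.
  have -> : dot d (Q *m phi1 (sig_w (s i)) (z i j) + hvec R k) =
      dot d (Q *m phi1 (sig_w (s i)) (z i j)) - dot (hvec R k) (- d).
    by rewrite dotDr dotNr opprK (dotC d (hvec R k)).
  rewrite subr_ge0 => hd; apply: le_trans (hd _ _) => [|i'|[y [hy _]]].
  - by rewrite -normrN dot_hvec_le_norm.
  - by rewrite ltey_eq fin_loss.
  - by apply: empty; exists y => l; have := hy l; rewrite !mxE lerBrDr.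
exists (@Variables R u v m r W N s M Qyy Q q
  (fun i j k => (sval (dualP i j k)).1) (fun i j k => (sval (dualP i j k)).2)
  (fun i => fine (L i))).
split=> //.
  by split=> // i j k; exact: (svalP (dualP i j k)).
rewrite /loss_objective /reformulation_objective EFinD.
rewrite [(N%:R^-1 * _)%:E]EFinM /=.
by rewrite EFin_sum_fine// => i _; exact: fin_loss.
Qed.

Theorem theorem4p5 (R : realType) (u v m r : nat) (hu : (0 < u)%N)
    (W : Type) (Z : W -> set 'cV[int]_v)
    (hZ : forall w : W, bounded_intset (Z w))
    (phi1 : W -> 'cV[int]_v -> 'cV[R]_m) (phi2 : W -> 'cV[int]_v -> 'cV[R]_r)
    (dz : 'cV[int]_v -> 'cV[int]_v -> R)
    (hdz : forall z z' : 'cV[int]_v, 0 <= dz z z')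
    (kappa : R) (hkappa : 0 <= kappa)
    (reg : 'cV[R]_(u * u + m * u + r) -> R)
    (Theta : set 'cV[R]_(u * u + m * u + r))
    (hTheta : forall (Qyy : 'M[R]_u) (Q : 'M[R]_(u, m)) (q : 'cV[R]_r),
      Theta (param Qyy Q q) -> psd Qyy)
    (N : nat) (hN : (0 < N)%N)
    (s : 'I_N -> signal R u v W) (xh : 'I_N -> response R u v)
    (hxh : forall i : 'I_N, feasible Z (s i) (xh i))
    (M : 'I_N -> nat) (z : forall i : 'I_N, 'I_(M i) -> 'cV[int]_v)
    (hz_inj : forall i : 'I_N, injective (z i))
    (hz : forall i : 'I_N, Z (sig_w (s i)) = range (z i))
    (hfib : no_ascent_on_empty_fibers Z phi1 phi2 dz Theta s xh) :
  let obj := loss_objective Z phi1 phi2 dz kappa reg s xh in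
  let F := reformulation_feasible phi1 phi2 dz Theta xh z in
  let robj := @reformulation_objective R u v m r W kappa reg N s M in
  optimal_value Theta obj = optimal_value F robj
  /\ (forall theta : 'cV[R]_(u * u + m * u + r),
        minimizer Theta obj theta
        <-> exists p : variables m r s M,
              minimizer F robj p /\ var_theta p = theta).
Proof.
have loss0 theta i : (0 <= loss Z phi1 phi2 dz theta (s i) (xh i))%E.
  exact: loss_ge0.
apply: projection_equivalence => [p Fp|theta].
  have [Tp _] := Fp; split=> //; rewrite ltry andbT.
  exact: reformulation_lower_bound (hTheta _ _ _ Tp) hz Fp.
have [Qyy [Q [q ->]]] := param_surj theta => Ttheta obj_fin.
have loss_fin i :
    loss Z phi1 phi2 dz (param Qyy Q q) (s i) (xh i) \is a fin_num.
  rewrite ge0_fin_numE//; exact: loss_objective_lt_pinfty obj_fin i.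
have [p [Fp pE objE]] := reformulation_lift hu kappa reg (hTheta _ _ _ Ttheta)
  hz hfib Ttheta loss_fin.
by exists p; split=> //; rewrite objE.
Qed.
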